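(* Let $(\mathcal{M},G,\operatorname{Exp})$ be either (a) the mean-parameter manifold of a regular exponential family with metric tensor $G$ and e-exponential map $\operatorname{Exp}$, or (b) $\mathcal{S}_n$ in ambient coordinates with its Fisher–Rao metric tensor and e-exponential map, all as defined in the context. Then, for all $x\in\mathcal{M}$ and $u,v\in T_x\mathcal{M}$, with $x'=\operatorname{Exp}_x(u)$, $$d\operatorname{Exp}_x(u)v=G(x')^{-1}G(x)v .$$
   Context: (a) Consider a regular (minimal) exponential family $p(y;\theta)=h(y)e^{\langle\theta,t(y)\rangle-\psi(\theta)}$ with natural parameter space $\Theta=\operatorname{dom}\psi=\mathbb{R}^d$ and log-partition function $\psi(\theta)=\log\int h(y)e^{\langle\theta,t(y)\rangle}dy$ (integral replaced by a sum in the discrete case); regular means that there are no affine dependencies among the components of the sufficient statistic $t$, so that $\psi$ is smooth with positive definite Hessian and is a Legendre function. Let $\mathcal{M}=\partial\psi(\Theta)$ (an open subset of $\mathbb{R}^d$, $T_x\mathcal{M}=\mathbb{R}^d$), $\phi=\psi^*$ the convex conjugate, so the maps $\theta\mapsto\eta(\theta)=\partial\psi(\theta)$ and $\eta\mapsto\theta(\eta)=\partial\phi(\eta)$ are mutually inverse bijections between $\Theta$ and $\mathcal{M}$, and $G(\eta)=\partial^2\phi(\eta)$ (Hessian). The e-exponential map is $\operatorname{Exp}_\eta(v)=\eta\big(\theta(\eta)+d\theta(\eta)v\big)$ for $v\in\mathbb{R}^d$. The points of $\mathcal{M}$, denoted $\eta$ here, are denoted $x$ in the claim. Instances: $\mathcal{P}_n=\mathbb{R}^n_{++}$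 with $G(x)=\operatorname{Diag}(\mathbf{1}/x)$; $\mathcal{B}_n=(0,1)^n$ with $G(x)=\operatorname{Diag}(\mathbf{1}/(x\cdot(\mathbf{1}-x)))$; $\{\eta\in\mathbb{R}^{n-1}_{++}:\langle\mathbf{1},\eta\rangle<1\}$ with $G(\eta)=\operatorname{Diag}(\mathbf{1}/\eta)+\frac{1}{1-\langle\mathbf{1},\eta\rangle}\mathbf{1}\mathbf{1}^\top$. (b) $\mathcal{S}_n=\{p\in\mathbb{R}^n:p_i>0\ \forall i,\ \langle\mathbf{1},p\rangle=1\}$, $T_x\mathcal{S}_n=\{v\in\mathbb{R}^n:\langle\mathbf{1},v\rangle=0\}$, $G(x)=\operatorname{Diag}(\mathbf{1}/x)$, where the inverse metric tensor in ambient coordinates, $G(x)^{-1}$, denotes the matrix $\Pi_x=\operatorname{Diag}(x)-xx^\top$, and $\operatorname{Exp}_x(v)=\dfrac{x\cdot e^{v/x}}{\langle x,e^{v/x}\rangle}$. Here $\mathbf{1}$ is the all-ones vector, vector products, quotients and exponentials are componentwise, $\partial$ denotes the gradient, and $d\operatorname{Exp}_x(u)v=\frac{d}{dt}\operatorname{Exp}_x(u+tv)|_{t=0}$. *)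

(* Defs.v *)
From HB Require Import structures.
From mathcomp Require Import all_boot all_order all_algebra.
From mathcomp Require Import all_classical all_reals all_analysis.

Set Implicit Arguments.
Unset Strict Implicit.
Unset Printing Implicit Defensive.
Import Order.TTheory GRing.Theory Num.Theory.
Import numFieldNormedType.Exports.
Local Open Scope classical_set_scope.
Local Open Scope ring_scope.

Definition dot (R : realType) (n : nat) (u v : 'cV[R]_n) : R :=
  \sum_i u i 0 * v i 0.

Definition grad (R : realType) (n : nat) (f : 'cV[R]_n -> R) (x : 'cV[R]_n) :
    'cV[R]_n :=
  \col_i 'D_(delta_mx i 0) f x.

Definition hessian (R : realType) (n : nat) (f : 'cV[R]_n -> R)
    (x : 'cV[R]_n) : 'M[R]_n :=
  \matrix_(i, j) 'D_(delta_mx i 0) (fun y => 'D_(delta_mx j 0) f y) x.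

Definition conjugate (R : realType) (n : nat) (f : 'cV[R]_n -> \bar R)
    (y : 'cV[R]_n) : \bar R :=
  ereal_sup (range (fun x => ((dot y x)%:E - f x)%E)).

(* An exponential family is given by a carrier h and a sufficient statistic t
   with respect to a reference measure mu, which covers at once the case of
   Lebesgue densities and the discrete case (counting measure). *)
Section exponential_family.
Context (R : realType) (d : measure_display) (Y : measurableType d).
Context (mu : {measure set Y -> \bar R}) (n : nat).
Context (h : Y -> R) (t : Y -> 'cV[R]_n).

(* Takes values in \bar R, with lne 0 = -oo and lne +oo = +oo. *)
Definition log_partition (theta : 'cV[R]_n) : \bar R :=
  lne (\int[mu]_y (h y * expR (dot theta (t y)))%:E).

(* Affine dependencies are understood up to null sets of the measure h dmu:
   the affine relation is only required to hold where h does not vanish. *)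
Record regular_exponential_family : Prop := RegularExponentialFamily {
  carrier_ge0 : forall y, 0 <= h y;
  carrier_measurable : measurable_fun setT h;
  statistic_measurable : forall i, measurable_fun setT (fun y => t y i 0);
  log_partition_fin_num : forall theta, log_partition theta \is a fin_num;
  statistic_affinely_independent : forall (a : 'cV[R]_n) (c : R),
    {ae mu, forall y, h y != 0 -> dot a (t y) = c} -> a = 0
}.

Definition mean_of_natural (theta : 'cV[R]_n) : 'cV[R]_n :=
  grad (fine \o log_partition) theta.

Definition mean_manifold : set 'cV[R]_n := range mean_of_natural.

Definition natural_of_mean (eta : 'cV[R]_n) : 'cV[R]_n :=
  grad (fine \o conjugate log_partition) eta.

Definition mean_metric (eta : 'cV[R]_n) : 'M[R]_n :=
  hessian (fine \o conjugate log_partition) eta.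

Definition mean_Exp (eta v : 'cV[R]_n) : 'cV[R]_n :=
  mean_of_natural (natural_of_mean eta + 'D_v natural_of_mean eta).

End exponential_family.

Definition open_simplex (R : realType) (n : nat) : set 'cV[R]_n :=
  [set p | (forall i, 0 < p i 0) /\ \sum_i p i 0 = 1].

Definition simplex_tangent (R : realType) (n : nat) : set 'cV[R]_n :=
  [set v | \sum_i v i 0 = 0].

Definition simplex_metric (R : realType) (n : nat) (x : 'cV[R]_n) : 'M[R]_n :=
  diag_mx (\row_i (x i 0)^-1).

(* The inverse metric tensor in ambient coordinates: not the matrix inverse of
   [simplex_metric x], but its composition with the projection onto the
   tangent space. *)
Definition simplex_cometric (R : realType) (n : nat) (x : 'cV[R]_n) :
    'M[R]_n :=
  diag_mx x^T - x *m x^T.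

Definition simplex_Exp (R : realType) (n : nat) (x v : 'cV[R]_n) : 'cV[R]_n :=
  \col_i (x i 0 * expR (v i 0 / x i 0)
          / \sum_j x j 0 * expR (v j 0 / x j 0)).

(* Main.v *)
Require Import Defs.
From HB Require Import structures.
From mathcomp Require Import all_boot all_order all_algebra.
From mathcomp Require Import all_classical all_reals all_analysis.
From mathcomp Require Import measurable_realfun.
From mathcomp Require Import ring lra.

Set Implicit Arguments.
Unset Strict Implicit.
Unset Printing Implicit Defensive.
Import Order.TTheory GRing.Theory Num.Theory.
Import numFieldNormedType.Exports.
Local Open Scope classical_set_scope.
Local Open Scope ring_scope.

(** Both halves express the differential of Exp through the differential of one
smooth map, and compare it with the metric.

For the exponential family write Z for the partition function, psi = ln Z,
m for the mean of the statistic t and Sigma for its covariance matrix, both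
as functions of the natural parameter. Once it is known that m is the gradient
of psi, that m has differential Sigma, and that the gradient of the conjugate
psi* is a differentiable inverse of m, the chain rule gives everything: the
metric at m(theta) is Sigma(theta)^-1, the map Exp sends v to
m(theta + Sigma(theta)^-1 v), and its differential at u is
Sigma(theta') Sigma(theta)^-1 with theta' = theta + Sigma(theta)^-1 u, that is
G(x')^-1 G(x).

Two ingredients supply these facts. The analytic one is that
theta |-> int g h e^<theta,t> has gradient with components
int t_i g h e^<theta,t>, for every g of at most exponential growth in t
([is_diff_moment]). As the partition function is finite on the whole space, all
such integrals converge, and the Taylor remainder of the exponential can be
integrated directly.

The convex one is that the tangent inequality
psi(a) + <m(a), b - a> < psi(b) for a <> b already encodes the Legendre
duality. In the family it is e^s > 1 + s integrated at s = <b - a, t - m(a)>,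
with strictness because t has no affine dependency
([log_partition_strict_subgradient]); the covariance is definite for the same
reason ([covariance_mx_unit]). It makes m injective and computes the conjugate
on the range of m. It also makes m open ([strict_subgradient_open]), since
psi - <y, .> keeps an interior minimum on a small ball when y is close to
m(a). Hence the inverse of m is continuous. A function with a continuous
subgradient is differentiable ([subgradient_is_diff]): this identifies both
grad psi = m and grad psi* = m^-1, and m^-1 has differential Sigma^-1 by
[is_diff_cancel].

For the simplex, Exp is explicit, and its Jacobian matrix is computed by the
quotient rule. *)

(** * Calculus on column vectors *)

Section dot_product.
Context {R : realType} {n : nat}.
Implicit Types a u v w : 'cV[R]_n.

Lemma dotC u v : dot u v = dot v u.
Proof. by apply: eq_bigr => i _; rewrite mulrC. Qed.

Lemma dot_is_linear a : linear (dot a).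
Proof.
move=> k u v; rewrite /dot scaler_sumr -big_split; apply: eq_bigr => i _.
by rewrite !mxE mulrDr mulrCA.
Qed.

HB.instance Definition _ a :=
  GRing.isLinear.Build R 'cV[R]_n R *:%R (dot a) (dot_is_linear a).

Lemma dotDl u v w : dot (u + v) w = dot u w + dot v w.
Proof. by rewrite dotC linearD/= !(dotC w). Qed.

Lemma dotNl u v : dot (- u) v = - dot u v.
Proof. by rewrite dotC linearN/= (dotC v). Qed.

Lemma dotBl u v w : dot (u - v) w = dot u w - dot v w.
Proof. by rewrite dotDl dotNl. Qed.

Lemma dotZl k u v : dot (k *: u) v = k * dot u v.
Proof. by rewrite dotC linearZ/= (dotC v). Qed.

Lemma dot_delta a i : dot a (delta_mx i 0) = a i 0.
Proof.
rewrite /dot (bigD1 i)//= mxE !eqxx mulr1 big1 ?addr0// => j ji.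
by rewrite mxE (negbTE ji) mulr0.
Qed.

Lemma dot_eq0 u : (dot u u == 0) = (u == 0).
Proof.
apply/eqP/eqP => [/psumr_eq0P u0|->]; last by rewrite linear0.
apply/colP => i; rewrite mxE; apply/eqP.
by rewrite -sqrf_eq0 expr2 u0// => j _; rewrite -expr2 sqr_ge0.
Qed.

Lemma dot_ge0 u : 0 <= dot u u.
Proof. by apply: sumr_ge0 => i _; rewrite -expr2 sqr_ge0. Qed.

End dot_product.

Section max_norm.
Context {R : realType} {m n : nat}.

Lemma normr_coord (A : 'M[R]_(m, n)) i j : `|A i j| <= `|A|.
Proof.
rewrite [leRHS]/Num.Def.normr/= mx_normrE.
exact: (le_bigmax _ (fun ij : 'I_m * 'I_n => `|A ij.1 ij.2|) (i, j)).
Qed.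

Lemma normr_mx_le (A : 'M[R]_(m, n)) c :
  0 <= c -> (forall i j, `|A i j| <= c) -> `|A| <= c.
Proof.
move=> c0 Ac; rewrite [leLHS]/Num.Def.normr/= mx_normrE.
by rewrite (bigmax_le _ c0)//= => -[].
Qed.

End max_norm.

Section column_vectors.
Context {R : realType} {n : nat}.

Lemma normr_dot_le (u v : 'cV[R]_n) : `|dot u v| <= n%:R * `|u| * `|v|.
Proof.
rewrite (le_trans (ler_norm_sum _ _ _))//.
have -> : n%:R * `|u| * `|v| = \sum_(i < n) `|u| * `|v|.
  by rewrite sumr_const card_ord -mulrA mulr_natl.
by apply: ler_sum => i _; rewrite normrM ler_pM ?normr_coord.
Qed.

Lemma linear_cV_le (W : normedModType R) (L : {linear 'cV[R]_n -> W}) v :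
  `|L v| <= (\sum_i `|L (delta_mx i 0)|) * `|v|.
Proof.
have -> : L v = \sum_i v i 0 *: L (delta_mx i 0).
  rewrite {1}(matrix_sum_delta v) linear_sum; apply: eq_bigr => i _.
  by rewrite big_ord_recl big_ord0 addr0 linearZ.
rewrite mulr_suml (le_trans (ler_norm_sum _ _ _))//; apply: ler_sum => i _.
by rewrite normrZ mulrC ler_wpM2l// normr_coord.
Qed.

Lemma linear_cV_continuous (W : normedModType R) (L : {linear 'cV[R]_n -> W}) :
  continuous L.
Proof.
apply: bounded_linear_continuous; apply/linear_boundedP.
exists (\sum_i `|L (delta_mx i 0)|); split => [|r Lr v]; first exact: num_real.
by rewrite (le_trans (linear_cV_le L v))// ler_wpM2r// ltW.
Qed.

Lemma near0_addl (x : 'cV[R]_n) (P : 'cV[R]_n -> Prop) :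
  (\forall y \near x, P y) <-> \forall d \near (0 : 'cV[R]_n), P (x + d).
Proof.
rewrite (near_shift 0) subr0; split; apply: filterS => d /=;
  by rewrite addrC.
Qed.

(** Linear maps out of a finite-dimensional space are continuous, so that the
remainder estimate alone characterizes a differential. *)
Lemma is_diffP (W : normedModType R) (f : 'cV[R]_n -> W)
    (L : {linear 'cV[R]_n -> W}) x :
  is_diff x f L <->
  forall e, 0 < e -> \forall d \near 0, `|f (x + d) - f x - L d| <= e * `|d|.
Proof.
split=> [[dfx dfE] e e0|fL].
  have /diff_locally/eqaddoP/(_ e e0) := dfx; rewrite dfE.
  apply: filterS => d /=; rewrite !fctE/= (addrC d x).
  by rewrite opprD addrA.
have feq : f \o shift x = cst (f x) + L +o_ 0 id.
  apply/eqaddoP => e e0; apply: filterS (fL e e0) => d /=.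
  by rewrite !fctE/= (addrC d x) opprD addrA.
have dfE := diff_unique (@linear_cV_continuous W L) feq.
by split => //; apply/diff_locallyP; rewrite dfE; split => //;
  exact: linear_cV_continuous.
Qed.

Lemma is_diff_linear (W : normedModType R) (L : {linear 'cV[R]_n -> W}) x :
  is_diff x L L.
Proof.
have L_cts := @linear_cV_continuous W L.
by split; [exact: linear_differentiable|exact: diff_lin].
Qed.

Lemma is_diff_derive (W : normedModType R) (f df : 'cV[R]_n -> W) x v :
  is_diff x f df -> is_derive x v f (df v).
Proof.
move=> [dfx <-]; split; [exact: diff_derivable|exact: deriveE].
Qed.

Lemma is_diff_mx m (f : 'cV[R]_n -> 'cV[R]_m) (A : 'M[R]_(m, n)) x :
  (forall i, is_diff x (fun y => f y i 0) (dot (row i A)^T)) ->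
  is_diff x f (mulmx A).
Proof.
move=> fA; apply/is_diffP => e e0.
near=> d; apply: normr_mx_le => [|i j]; first by rewrite mulr_ge0// ltW.
rewrite (ord1 j) {j} !mxE.
have -> : \sum_j A i j * d j 0 = dot (row i A)^T d.
  by apply: eq_bigr => j _; rewrite !mxE.
move: i; near: d; apply: filter_forall => i.
exact/(is_diffP _ _ _).1.
Unshelve. all: by end_near. Qed.

(** Testing the subgradient inequality at [x] and at [y] squeezes the
first-order remainder f y - f x - <s x, y - x> between 0 and
<s y - s x, y - x>, which is o(y - x) when [s] is continuous at [x]. *)
Lemma subgradient_is_diff (f : 'cV[R]_n -> R) (s : 'cV[R]_n -> 'cV[R]_n) x :
  {for x, continuous s} ->
  (\forall y \near x, f x + dot (s x) (y - x) <= f y) ->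
  (\forall y \near x, f y + dot (s y) (x - y) <= f x) ->
  is_diff x f (dot (s x)).
Proof.
move=> sx fx fy; apply/is_diffP => e e0.
have e1 : 0 < e / n.+1%:R by rewrite divr_gt0.
have {}sx : \forall y \near x, `|s x - s y| <= e / n.+1%:R.
  by move/cvgrPdist_le : sx; apply.
have H : \forall y \near x, `|s x - s y| <= e / n.+1%:R /\
    f x + dot (s x) (y - x) <= f y /\ f y + dot (s y) (x - y) <= f x.
  by near=> y; split; [near: y|split; near: y].
move/near0_addl : H; apply: filterS => d; set y := x + d.
move=> [sxy [h1 h2]].
have yx : y - x = d by rewrite /y addrC addKr.
have xy : x - y = - d by rewrite -opprB yx.
rewrite yx in h1; rewrite xy linearN/= in h2.
have h3 : 0 <= f y - f x - dot (s x) d by lra.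
rewrite ger0_norm//.
have h4 : f y - f x - dot (s x) d <= dot (s y - s x) d by rewrite dotBl; lra.
rewrite (le_trans h4)// (le_trans (ler_norm _))//.
rewrite (le_trans (normr_dot_le _ _))// ler_wpM2r// distrC.
rewrite (le_trans (ler_wpM2l (ler0n _ n) sxy))//.
by rewrite mulrCA ler_piMr ?(ltW e0)// ler_pdivrMr// mul1r ler_nat.
Unshelve. all: by end_near. Qed.

End column_vectors.

(** * Compactness of balls and spheres *)

Section compactness.
Context {R : realType} {n : nat}.

Lemma normr_trmx m (A : 'M[R]_(m, n)) : `|A^T| = `|A|.
Proof.
apply/eqP; rewrite eq_le; apply/andP; split;
  apply: normr_mx_le => // i j; first by rewrite mxE normr_coord.
by have := normr_coord A^T j i; rewrite mxE.
Qed.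

Lemma bounded_closed_compact_cV (A : set 'cV[R]_n) :
  bounded_set A -> closed A -> compact A.
Proof.
move=> bA cA; pose B := [set w : 'rV[R]_n | A w^T].
have tr_cts : continuous (trmx : 'rV[R]_n -> 'cV[R]_n).
  move=> w; apply/(@cvgrPdist_lt _ _ _ (nbhs w)) => e e0.
  apply: filterS (nbhsx_ballx w e e0) => w'; rewrite -ball_normE.
  by rewrite /ball_/= -linearB/= normr_trmx.
have -> : A = trmx @` B.
  apply/seteqP; split => [v Av|_ [w Bw <-]//]; exists v^T; rewrite ?trmxK//.
  by rewrite /B/= trmxK.
apply: continuous_compact; first exact: continuous_subspaceT.
apply: bounded_closed_compact; last by move/continuous_closedP : tr_cts; exact.
case: bA => M [Mr MA]; exists M; split => // r Mr' w Bw /=.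
rewrite -normr_trmx; exact: MA Bw.
Qed.

(** Covers the closed ball, [D] being the reals up to the radius, and the
sphere, [D] being the radius alone. *)
Lemma dist_set_compact (D : set R) (x : 'cV[R]_n) e :
  closed D -> (forall r, D r -> r <= e) -> compact [set y | D `|y - x|].
Proof.
move=> cD De; apply: bounded_closed_compact_cV.
  exists (`|x| + e); split; first exact: num_real.
  move=> r xer y /= /De yxe; rewrite (le_trans _ (ltW xer))//.
  by rewrite -(subrK x y) addrC (le_trans (ler_normD _ _))// lerD2l.
have : continuous (fun y : 'cV[R]_n => `|y - x|).
  move=> y.
  apply: (@continuous_comp _ _ _ (fun y : 'cV[R]_n => y - x) Num.norm).
    exact: (@continuousB _ _ _ _ _ _ (@cvg_id _ _) (@cst_continuous _ _ _ _)).
  exact: norm_continuous.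
by move/continuous_closedP; exact.
Qed.

End compactness.

(** * Legendre duality from the strict tangent inequality *)

Section legendre_duality.
Context {R : realType} {n : nat}.
Implicit Types (psi : 'cV[R]_n -> R) (gr : 'cV[R]_n -> 'cV[R]_n).
Implicit Types (a b : 'cV[R]_n).

(** The inequality that characterizes [gr] as the gradient of a strictly convex
[psi]: with [gr] continuous, grad psi = gr is a consequence
([grad_subgradient]). *)
Definition strict_subgradient psi gr :=
  forall a b, a != b -> psi a + dot (gr a) (b - a) < psi b.

Lemma strict_subgradient_le psi gr a b :
  strict_subgradient psi gr -> psi a + dot (gr a) (b - a) <= psi b.
Proof.
move=> pg; have [->|/pg/ltW//] := eqVneq a b.
by rewrite subrr linear0 addr0.
Qed.

Lemma strict_subgradient_inj psi gr : strict_subgradient psi gr -> injective gr.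
Proof.
move=> pg a b grab; apply/eqP; apply: contraT => ab.
have := pg _ _ ab; rewrite eq_sym in ab; have := pg _ _ ab.
by rewrite grab -(opprB b a) linearN/=; lra.
Qed.

Lemma conjugate_subgradient psi gr a : strict_subgradient psi gr ->
  conjugate (EFin \o psi) (gr a) = (dot (gr a) a - psi a)%:E.
Proof.
move=> pg; apply/eqP; rewrite eq_le; apply/andP; split.
  apply: ge_ereal_sup => _ [b _ <-]/=; rewrite -EFinB lee_fin.
  have := strict_subgradient_le a b pg; rewrite linearB/=; lra.
by apply: ereal_sup_ubound; exists a => //=; rewrite EFinB.
Qed.

(** A point y close to gr a is a value of [gr] near a: on a small sphere around
a, psi - <gr a, .> exceeds its value at a by some c > 0, and so does
psi - <y, .> with a smaller excess. Its minimum m over the closed ball is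
therefore interior, and gr m = y there. *)
Lemma strict_subgradient_open psi gr a (U : set 'cV[R]_n) :
  strict_subgradient psi gr -> continuous psi -> continuous gr ->
  nbhs a U -> nbhs (gr a) (gr @` U).
Proof.
move=> pg cpsi cgr /nbhs_normP[r /= r0 aU].
pose e := r / 2; have e0 : 0 < e by rewrite divr_gt0.
have linear_cts b : continuous (dot b : 'cV[R]_n -> R).
  exact: linear_cV_continuous.
pose S := [set b : 'cV[R]_n | `|b - a| = e].
(* In dimension 0 the sphere is empty and any c > 0 will do. *)
have [c c0 Sc] : exists2 c, 0 < c &
    forall b, S b -> psi a + dot (gr a) (b - a) + c <= psi b.
  have [[b0 Sb0]|/set0P/negP/negPn/eqP S0] := pselect (S !=set0); last first.
    by exists 1 => // b; rewrite -/(S b) S0.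
  have cS : compact S.
    apply: (@dist_set_compact _ _ [set e] a e); first exact: closed_eq.
    by move=> _ ->.
  have := @compact_EVT_min _ _ (fun b => psi b - dot (gr a) b) S.
  move=> /(_ _ cS)[||m mS min_m]; first by exists b0.
    apply: continuous_subspaceT => b.
    by apply: continuousB; [exact: cpsi|exact: linear_cts].
  rewrite inE in mS.
  have am : a != m.
    apply: contraTneq e0 => am; move: mS; rewrite /S/= -am subrr normr0 => <-.
    by rewrite ltxx.
  exists (psi m - (psi a + dot (gr a) (m - a))); first by rewrite subr_gt0 pg.
  move=> b /mem_set/min_m; rewrite !linearB/=; lra.
(* |<y - gr a, b - a>| <= n d e < c on the sphere; n.+1 keeps the quotient
   meaningful in dimension 0. *)
pose d := c / (n.+1%:R * e).
have d0 : 0 < d by rewrite divr_gt0// mulr_gt0.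
apply: filterS (nbhsx_ballx (gr a) d d0) => y.
rewrite -ball_normE /ball_/= => yd.
pose p b := psi b - dot y b.
have cK : compact [set b : 'cV[R]_n | `|b - a| <= e].
  by apply: (@dist_set_compact _ _ [set t | t <= e] a e).
have [||m mK min_m] := @compact_EVT_min _ _ p _ _ cK.
- by exists a; rewrite /= subrr normr0 ltW.
- apply: continuous_subspaceT => b.
  by apply: continuousB; [exact: cpsi|exact: linear_cts].
rewrite inE/= in mK.
have {}mK : `|m - a| < e.
  rewrite lt_neqAle mK andbT; apply/eqP => mS.
  have := Sc m mS; have := min_m a.
  rewrite inE/= subrr normr0 (ltW e0) => /(_ isT).
  have : dot (y - gr a) (m - a) < c.
    rewrite (le_lt_trans (ler_norm _))// (le_lt_trans (normr_dot_le _ _))//.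
    rewrite mS distrC (@le_lt_trans _ _ (n.+1%:R * `|gr a - y| * e))//.
      by rewrite !ler_wpM2r ?(ltW e0)// ler_nat.
    by rewrite mulrAC mulrC -ltr_pdivlMr ?mulr_gt0.
  rewrite /p dotBl !linearB/=; lra.
exists m.
  by apply: aU; rewrite /ball_/= distrC (lt_trans mK)// /e; lra.
(* First-order condition. Otherwise, moving from m by a small step s along
   w := y - gr m, the tangent inequality at m + s w shows that psi - <y, .>
   drops by at least s <y - gr (m + s w), w>, which for small s is positive by
   continuity, as <y - gr m, w> is. *)
apply/eqP; rewrite eq_sym -subr_eq0 -dot_eq0; set w := y - gr m.
rewrite eq_le dot_ge0 andbT leNgt; apply/negP => w0.
have : \forall z \near m, `|z - a| <= e /\ dot w (gr z) < dot w y.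
  have cw : {for m, continuous (fun z => dot w (gr z))}.
    by apply: continuous_comp; [exact: cgr|exact: linear_cts].
  near=> z; split; near: z.
    apply: filterS (nbhsx_ballx m (e - `|m - a|) _); last by rewrite subr_gt0.
    move=> z; rewrite -ball_normE /ball_/= => mz.
    have := ler_normD (z - m) (m - a); rewrite addrA subrK (distrC z m); lra.
  by move/cvgr_lt : cw; apply; rewrite /w linearB/= in w0 *; lra.
move=> /nbhs_normP[rho /= rho0 m_rho].
have wn0 : 0 < `|w|.
  by rewrite normr_gt0; apply: contraTneq w0 => ->; rewrite linear0 ltxx.
pose s := rho / 2 / `|w|.
have s0 : 0 < s by rewrite !divr_gt0.
have [|mK' wlt] := m_rho (m + s *: w).
  rewrite /ball_/= opprD addrA subrr sub0r normrN normrZ gtr0_norm//.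
  rewrite divfK ?gt_eqF//; lra.
have := min_m (m + s *: w); rewrite inE/= => /(_ mK').
have := strict_subgradient_le (m + s *: w) m pg.
have -> : m - (m + s *: w) = - (s *: w) by rewrite opprD addrA subrr sub0r.
rewrite /p !(dotC y) (dotC (gr (m + s *: w))) dotNl dotDl !dotZl.
have : s * dot w (gr (m + s *: w)) < s * dot w y by rewrite ltr_pM2l.
lra.
Unshelve. all: by end_near. Qed.

End legendre_duality.

(** * Differential of the inverse gradient *)

Section inverse_differential.
Context {R : realType} {n : nat}.
Implicit Types (psi : 'cV[R]_n -> R) (f g gr : 'cV[R]_n -> 'cV[R]_n).
Implicit Types a b : 'cV[R]_n.

Lemma cancel_open_continuous f g a : cancel f g ->
  (forall U, nbhs a U -> nbhs (f a) (f @` U)) -> {for f a, continuous g}.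
Proof.
move=> fK fo U; rewrite fK => /fo; apply: filterS => _ [b Ub <-].
by rewrite /preimage/= fK.
Qed.

(** The differential of the inverse map, with openness of [f] in place of
continuous differentiability: openness lets f (a + d) run through a
neighbourhood of f a with d small, and solving f (a + d) - f a = A d + o(d) for
d bounds |d| by a multiple of |f (a + d) - f a|. *)
Lemma is_diff_cancel f g a (A : 'M[R]_n) : cancel f g ->
  (forall U, nbhs a U -> nbhs (f a) (f @` U)) -> A \in unitmx ->
  is_diff a f (mulmx A) -> is_diff (f a) g (mulmx (invmx A)).
Proof.
move=> fK fo Au /is_diffP fA; apply/is_diffP => e e0.
(* C bounds the operator norm of the inverse of A. *)
pose C := 1 + \sum_i `|invmx A *m delta_mx i 0 : 'cV[R]_n|.
have C1 : 1 <= C by rewrite lerDl sumr_ge0.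
have C0 : 0 < C by rewrite (lt_le_trans ltr01).
have Cle (v : 'cV[R]_n) : `|invmx A *m v| <= C * `|v|.
  rewrite (le_trans (linear_cV_le (mulmx (invmx A)) v))// ler_wpM2r//.
  by rewrite lerDr.
(* The first bound absorbs |d| and gives |d| <= 2 C |k|; the second turns the
   error C e' |d| into at most e |k|. *)
pose e' := Num.min (C^-1 / 2) (e / (2 * C ^+ 2)).
have e'0 : 0 < e' by rewrite lt_min !divr_gt0 ?invr_gt0// mulr_gt0// exprn_gt0.
have Ce' : C * e' <= 1 / 2.
  by rewrite -ler_pdivlMl// mulrA mulr1 ge_min lexx.
have CCe' : 2 * C ^+ 2 * e' <= e.
  rewrite -ler_pdivlMl ?mulr_gt0 ?exprn_gt0//.
  by rewrite mulrC /e' ge_min lexx orbT.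
have fAe : \forall b \near a, `|f b - f a - A *m (b - a)| <= e' * `|b - a|.
  apply/near0_addl; apply: filterS (fA _ e'0) => d.
  by rewrite /= [a + d - a]addrC addKr.
have /near0_addl := fo _ fAe; apply: filterS => k [b + bE]/=.
rewrite -bE !fK.
set d := b - a; have -> : f b - f a = k by rewrite bE [f a + k]addrC addrK.
move=> kAd.
have dA : `|d - invmx A *m k| <= C * (e' * `|d|).
  rewrite -(mulKmx Au d) -mulmxBr (le_trans (Cle _))// ler_wpM2l ?(ltW C0)//.
  by rewrite mulKmx// distrC.
have dk : `|d| <= 2 * C * `|k|.
  have h1 : C * (e' * `|d|) <= 1 / 2 * `|d| by rewrite mulrA ler_wpM2r.
  have := ler_normD (d - invmx A *m k) (invmx A *m k); rewrite subrK.
  have := Cle k; lra.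
rewrite (le_trans dA)// (le_trans _ (ler_wpM2r (normr_ge0 k) CCe'))//.
rewrite (le_trans (ler_wpM2l (ltW C0) (ler_wpM2l (ltW e'0) dk)))//.
by rewrite le_eqVlt; apply/orP; left; apply/eqP; ring.
Qed.

Lemma subgradient_continuous psi gr :
  strict_subgradient psi gr -> continuous gr -> continuous psi.
Proof.
move=> pg cgr a; apply: differentiable_continuous.
suff [] : is_diff a psi (dot (gr a)) by [].
by apply: (subgradient_is_diff (cgr a)); near=> b; exact: strict_subgradient_le.
Unshelve. all: by end_near. Qed.

Lemma is_diff_grad (f : 'cV[R]_n -> R) a v :
  is_diff a f (dot v) -> grad f a = v.
Proof.
move=> fv; apply/colP => i; rewrite mxE -(dot_delta v i).
by have [_ ->] := is_diff_derive (delta_mx i 0) fv.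
Qed.

Lemma grad_subgradient psi gr :
  strict_subgradient psi gr -> continuous gr -> grad psi = gr.
Proof.
move=> pg cgr; apply/funext => a; apply: is_diff_grad.
by apply: (subgradient_is_diff (cgr a)); near=> b; exact: strict_subgradient_le.
Unshelve. all: by end_near. Qed.

(** The conjugate is explicit on the range of [gr], which is open, and a is a
subgradient of it at gr a; this selection is continuous because [gr] is open.
*)
Lemma grad_conjugateK psi gr : strict_subgradient psi gr -> continuous gr ->
  cancel gr (grad (fine \o conjugate (EFin \o psi))).
Proof.
move=> pg cgr a.
have gr_inj := strict_subgradient_inj pg.
pose T y := xget 0 (gr @^-1` [set y]).
have TK : cancel gr T.
  move=> b; apply: gr_inj.
  by apply: (xgetPex 0 (P := gr @^-1` [set gr b])); exists b.
have gr_open U : nbhs a U -> nbhs (gr a) (gr @` U).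
  by move/(strict_subgradient_open pg (subgradient_continuous pg cgr) cgr).
have conjE b : (fine \o conjugate (EFin \o psi)) (gr b) = dot (gr b) b - psi b.
  by rewrite /= (conjugate_subgradient _ pg).
have near_gr (P : 'cV[R]_n -> Prop) :
    (forall b, P (gr b)) -> \forall y \near gr a, P y.
  move=> Pgr; apply: filterS (gr_open setT filterT) => _ [b _ <-]; exact: Pgr.
rewrite -[RHS]TK; apply: is_diff_grad; apply: subgradient_is_diff.
- exact: cancel_open_continuous TK gr_open.
- apply: near_gr => b; rewrite TK !conjE.
  have := strict_subgradient_le b a pg; rewrite !linearB/= !(dotC a); lra.
- apply: near_gr => b; rewrite !TK !conjE.
  have := strict_subgradient_le a b pg; rewrite !linearB/= !(dotC b); lra.
Qed.

Lemma is_diff_grad_conjugate psi gr (H : 'cV[R]_n -> 'M[R]_n) a :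
  strict_subgradient psi gr -> (forall b, is_diff b gr (mulmx (H b))) ->
  H a \in unitmx ->
  is_diff (gr a) (grad (fine \o conjugate (EFin \o psi))) (mulmx (invmx (H a))).
Proof.
move=> pg dgr Hu.
have cgr : continuous gr.
  by move=> b; apply: differentiable_continuous; case: (dgr b).
apply: is_diff_cancel Hu (dgr a); first exact: grad_conjugateK.
by move=> U; exact: strict_subgradient_open (subgradient_continuous pg cgr) cgr.
Qed.

(** The transpose appears because entry (i, j) of [hessian] differentiates the
j-th component of the gradient in direction i. *)
Lemma is_diff_hessian (f : 'cV[R]_n -> R) a (A : 'M[R]_n) :
  is_diff a (grad f) (mulmx A) -> hessian f a = A^T.
Proof.
move=> fA; apply/matrixP => i j; rewrite !mxE.
have [dfA eqA] := is_diff_derive (delta_mx i 0) fA.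
have -> : (fun y => 'D_(delta_mx j 0) f y) = (fun y => grad f y j 0).
  by apply/funext => y; rewrite mxE.
by have /matrixP/(_ j 0) := derive_mx dfA; rewrite eqA -colE !mxE => ->.
Qed.

End inverse_differential.

(** * Exponentials and quotients *)

Section exponentials_and_quotients.
Context {R : realType} {n : nat}.
Implicit Types (a b u v x : 'cV[R]_n).

(** By 1 + s <= e^s at s and at -s, s <= e^s - 1 <= s e^s. Hence the remainder
is between 0 and s (e^s - 1), and this is at most s^2 e^s if s >= 0 and at most
s^2 if s <= 0. *)
Lemma expR_taylor1_le (s : R) : `|expR s - 1 - s| <= s ^+ 2 * expR `|s|.
Proof.
have h1 := expR_ge1Dx s; have h2 := expR_ge1Dx (- s).
have := expR_gt0 s; have := expRN s => eN p.
rewrite ger0_norm; last lra.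
have h3 : expR s * expR (- s) = 1 by rewrite eN mulfV ?gt_eqF.
have h4 : expR s * (1 - s) <= 1 by have := ler_wpM2l (ltW p) h2; rewrite h3.
have [s0|s0] := ger0P s.
  have : s * (expR s - 1) <= s * (s * expR s) by rewrite ler_wpM2l//; lra.
  lra.
apply: (@le_trans _ _ (s ^+ 2)).
  have : s * (expR s - 1) <= s * s by rewrite ler_wnM2l ?(ltW s0)//; lra.
  lra.
by rewrite ler_peMr ?sqr_ge0// -expR0 ler_expR oppr_ge0 ltW.
Qed.

Lemma ltr_ln_addr (r s c : R) : 0 < r -> 0 < s ->
  r < expR (- c) * s -> ln r + c < ln s.
Proof.
move=> r0 s0 rs; rewrite -ltr_expR expRD !lnK// -ltr_pdivlMr ?expR_gt0//.
by rewrite -expRN mulrC.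
Qed.

Lemma is_diff_div (f g : 'cV[R]_n -> R) (a b x : 'cV[R]_n) :
  is_diff x f (dot a) -> is_diff x g (dot b) -> g x != 0 ->
  is_diff x (fun y => f y / g y)
    (dot ((g x)^-1 *: a - (f x / g x ^+ 2) *: b)).
Proof.
move=> fa gb gx0.
have gV : is_diff x (fun y => (g y)^-1) (fun v => - (g x) ^- 2 * dot b v).
  have dg : differentiable g x by [].
  split; first exact: differentiableV.
  rewrite diffV//; apply/funext => v; rewrite /=.
  by rewrite (@diff_val _ _ _ _ _ _ _ gb).
have fg : is_diff x (fun y => f y / g y) _ := is_diffM fa gV.
apply: is_diff_eq fg _; apply/funext => v; rewrite dotBl !dotZl.
change (f x * (- g x ^- 2 * dot b v) + (g x)^-1 * dot a v =
        (g x)^-1 * dot a v - f x / g x ^+ 2 * dot b v).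
by field.
Qed.

Lemma is_diff_expR_dot (c : R) a u :
  is_diff u (fun w => c * expR (dot a w)) (dot ((c * expR (dot a u)) *: a)).
Proof.
have da : is_diff u (dot a : 'cV[R]_n -> R) (dot a).
  exact: is_diff_linear.
have de : is_diff (dot a u) (@expR R) (fun s => s * expR (dot a u)).
  have dexp : derivable (@expR R) (dot a u) 1 by exact: derivable_expR.
  split; first exact/derivable1_diffP.
  by have [_ e1] := is_derive_expR (dot a u); rewrite deriv1E// derive1E e1.
have dce : is_diff u (fun w => c * expR (dot a w)) _ :=
  is_diffZ c (is_diff_comp da de).
apply: is_diff_eq dce _; apply/funext => v; rewrite dotZl.
by change (c * (dot a v * expR (dot a u)) = c * expR (dot a u) * dot a v); ring.
Qed.

Lemma is_diff_sum (I : Type) (s : seq I) (f : I -> 'cV[R]_n -> R)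
    (a : I -> 'cV[R]_n) u :
  (forall i, is_diff u (f i) (dot (a i))) ->
  is_diff u (fun w => \sum_(i <- s) f i w) (dot (\sum_(i <- s) a i)).
Proof.
move=> fa; elim: s => [|i s IHs].
  have d0 : is_diff u (fun w : 'cV[R]_n => 0 : R) _ := is_diff_cst 0 u.
  under eq_fun do rewrite big_nil.
  apply: is_diff_eq d0 _; apply/funext => v.
  by rewrite big_nil dotC linear0.
under eq_fun do rewrite big_cons.
have dD : is_diff u (fun w => f i w + \sum_(j <- s) f j w) _ :=
  is_diffD (fa i) IHs.
by apply: is_diff_eq dD _; apply/funext => v; rewrite big_cons dotDl.
Qed.

End exponentials_and_quotients.

(** * Moments of an exponential family *)

Section exponential_family_moments.
Context {R : realType} {d : measure_display} {Y : measurableType d}.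
Context (mu : {measure set Y -> \bar R}) (n : nat).
Context (h : Y -> R) (t : Y -> 'cV[R]_n).
Context (fam : regular_exponential_family mu h t).
Implicit Types (theta v : 'cV[R]_n) (g : Y -> R).

Definition statistic_norm y := \sum_i `|t y i 0|.

(** The integrands for which all moments converge; they form an algebra that
contains the components of the statistic and the exponentials of its linear
forms. *)
Definition exp_bounded g := measurable_fun setT g /\
  exists C, exists k : nat, forall y,
    `|g y| <= C * expR (k%:R * statistic_norm y).

(** Unnormalized: the total mass is the partition function. *)
Definition density theta y := h y * expR (dot theta (t y)).

Definition moment theta g : R := \int[mu]_y (g y * density theta y).

Lemma statistic_norm_ge0 y : 0 <= statistic_norm y.
Proof. exact: sumr_ge0. Qed.
Local Hint Resolve statistic_norm_ge0 : core.

Lemma normr_dot_statistic v y : `|dot v (t y)| <= `|v| * statistic_norm y.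
Proof.
rewrite mulr_sumr (le_trans (ler_norm_sum _ _ _))//; apply: ler_sum => i _.
by rewrite normrM ler_wpM2r ?normr_coord.
Qed.

Lemma measurable_dot v : measurable_fun setT (fun y => dot v (t y)).
Proof.
apply: measurable_sum => i; apply: measurable_funM; first exact: measurable_cst.
exact: (statistic_measurable fam).
Qed.

Lemma exp_bounded_cst c : exp_bounded (cst c).
Proof.
split; first exact: measurable_cst.
by exists `|c|, 0%N => y; rewrite mul0r expR0 mulr1.
Qed.

Lemma exp_boundedM g1 g2 : exp_bounded g1 -> exp_bounded g2 ->
  exp_bounded (g1 \* g2).
Proof.
move=> [m1 [C1 [k1 g1C]]] [m2 [C2 [k2 g2C]]].
split; first exact: measurable_funM.
exists (C1 * C2), (k1 + k2)%N => y /=.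
by rewrite normrM natrD mulrDl expRD mulrACA ler_pM.
Qed.

Lemma exp_boundedD g1 g2 : exp_bounded g1 -> exp_bounded g2 ->
  exp_bounded (g1 \+ g2).
Proof.
move=> [m1 [C1 [k1 g1C]]] [m2 [C2 [k2 g2C]]].
split; first exact: measurable_funD.
exists (C1 + C2), (k1 + k2)%N => y /=.
have incr C (k l : nat) x : (k <= l)%N -> 0 <= x ->
    x <= C * expR (k%:R * statistic_norm y) ->
    x <= C * expR (l%:R * statistic_norm y).
  move=> kl x0 xC; have C0 : 0 <= C.
    rewrite -(pmulr_lge0 _ (expR_gt0 (k%:R * statistic_norm y)))//.
    exact: le_trans xC.
  by rewrite (le_trans xC)// ler_wpM2l// ler_expR ler_wpM2r// ler_nat.
rewrite (le_trans (ler_normD _ _))// mulrDl lerD//.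
  by apply: incr (g1C y) => //; exact: leq_addr.
by apply: incr (g2C y) => //; exact: leq_addl.
Qed.

Lemma exp_boundedZ c g : exp_bounded g -> exp_bounded (fun y => c * g y).
Proof. exact/exp_boundedM/exp_bounded_cst. Qed.

Lemma exp_boundedN g : exp_bounded g -> exp_bounded (fun y => - g y).
Proof.
move=> /(exp_boundedZ (-1)); congr exp_bounded; apply/funext => y.
by rewrite mulN1r.
Qed.

Lemma exp_boundedB g1 g2 : exp_bounded g1 -> exp_bounded g2 ->
  exp_bounded (fun y => g1 y - g2 y).
Proof. by move=> g1b /exp_boundedN; exact: exp_boundedD. Qed.

Lemma exp_bounded_norm g : exp_bounded g -> exp_bounded (fun y => `|g y|).
Proof.
move=> [mg [C [k gC]]]; split; first exact: measurableT_comp.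
by exists C, k => y; rewrite normr_id.
Qed.

Lemma exp_bounded_sum (I : Type) (s : seq I) (g : I -> Y -> R) :
  (forall i, exp_bounded (g i)) -> exp_bounded (fun y => \sum_(i <- s) g i y).
Proof.
move=> gb; elim: s => [|i s IHs].
  by under eq_fun do rewrite big_nil; exact: exp_bounded_cst.
by under eq_fun do rewrite big_cons; exact: exp_boundedD.
Qed.

Lemma exp_bounded_coord i : exp_bounded (fun y => t y i 0).
Proof.
split; first exact: (statistic_measurable fam).
exists 1, 1%N => y; rewrite !mul1r.
apply: (@le_trans _ _ (statistic_norm y)).
  by rewrite /statistic_norm (bigD1 i)//= lerDl sumr_ge0.
by rewrite (le_trans _ (expR_ge1Dx _))// lerDr.
Qed.

Lemma exp_bounded_dot v : exp_bounded (fun y => dot v (t y)).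
Proof.
apply: exp_bounded_sum => i; exact/exp_boundedZ/exp_bounded_coord.
Qed.

Lemma exp_bounded_statistic_norm : exp_bounded statistic_norm.
Proof.
by apply: exp_bounded_sum => i; exact/exp_bounded_norm/exp_bounded_coord.
Qed.

Lemma exp_bounded_expR g (k : nat) : measurable_fun setT g ->
  (forall y, g y <= k%:R * statistic_norm y) -> exp_bounded (expR \o g).
Proof.
move=> mg gk; split; first exact: measurableT_comp.
by exists 1, k => y; rewrite mul1r/= ger0_norm ?expR_ge0// ler_expR.
Qed.

Lemma exp_bounded_expR_dot v : exp_bounded (fun y => expR (dot v (t y))).
Proof.
apply: (@exp_bounded_expR _ (Num.truncn `|v|).+1); first exact: measurable_dot.
move=> y; rewrite (le_trans (ler_norm _))//.
rewrite (le_trans (normr_dot_statistic _ _))//.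
by rewrite ler_wpM2r// ltW// truncnS_gt.
Qed.

Lemma density_ge0 theta y : 0 <= density theta y.
Proof. by rewrite mulr_ge0 ?expR_ge0// (carrier_ge0 fam). Qed.

Lemma densityD theta v y :
  density (theta + v) y = expR (dot v (t y)) * density theta y.
Proof. by rewrite /density dotDl expRD mulrA mulrC. Qed.

Lemma measurable_density theta : measurable_fun setT (density theta).
Proof.
apply: measurable_funM; first exact: (carrier_measurable fam).
exact/(measurableT_comp (@measurable_expR R))/measurable_dot.
Qed.

Lemma integrable_density theta : mu.-integrable setT (EFin \o density theta).
Proof.
apply/integrableP; split; first exact/measurable_EFinP/measurable_density.
rewrite (eq_integral (EFin \o density theta)); last first.
  by move=> y _ /=; rewrite ger0_norm ?density_ge0.
rewrite ltey; apply/eqP => intE.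
by have := log_partition_fin_num fam theta; rewrite /log_partition intE.
Qed.

(** The l1 norm is at most n times the absolute value of some component, and
e^|r| <= e^r + e^-r; the right-hand side is thus a sum of exponentials of linear
forms, whose integrals are values of the partition function. *)
Lemma expR_statistic_norm_le (k : nat) y :
  expR (k%:R * statistic_norm y) <= 1 + \sum_i
    (expR (dot ((k * n)%:R *: delta_mx i 0) (t y)) +
     expR (dot (- (k * n)%:R *: delta_mx i 0) (t y))).
Proof.
have S0 : 0 <= \sum_i (expR (dot ((k * n)%:R *: delta_mx i 0) (t y)) +
     expR (dot (- (k * n)%:R *: delta_mx i 0) (t y))).
  by apply: sumr_ge0 => i _; rewrite addr_ge0 ?expR_ge0.
have normE : statistic_norm y <= n%:R * `|t y|.
  rewrite mulr_natl -[X in _ *+ X]card_ord -sumr_const; apply: ler_sum => i _.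
  exact: normr_coord.
have [t0|/mx_norm_neq0[[i j]]] := eqVneq (mx_norm (t y)) 0.
  rewrite (@le_trans _ _ 1) ?lerDl// -expR0 ler_expR.
  by rewrite mulr_ge0_le0// (le_trans normE)// [`|t y|]t0 mulr0.
rewrite (ord1 j) /= => tE.
rewrite (bigD1 i)//= !dotZl !(dotC (delta_mx i 0)) !dot_delta.
have le1 : expR (k%:R * statistic_norm y) <=
  expR ((k * n)%:R * t y i 0) + expR (- (k * n)%:R * t y i 0).
  apply: (@le_trans _ _ (expR ((k * n)%:R * `|t y i 0|))).
    by rewrite ler_expR natrM -mulrA ler_wpM2l// (le_trans normE)// [`|t y|]tE.
  have [ti|ti] := ger0P (t y i 0); first by rewrite lerDl expR_ge0.
  by rewrite mulrN -mulNr lerDr expR_ge0.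
rewrite (le_trans le1)// addrCA lerDl addr_ge0//; apply: sumr_ge0 => j' _.
by rewrite addr_ge0 ?expR_ge0.
Qed.

Lemma integrable_moment theta g : exp_bounded g ->
  mu.-integrable setT (EFin \o (fun y => g y * density theta y)).
Proof.
move=> [mg [C [k gC]]].
have C0 (y : Y) : 0 <= C.
  rewrite -(pmulr_lge0 _ (expR_gt0 (k%:R * statistic_norm y))).
  exact: le_trans (gC y).
apply: (@le_integrable _ _ _ mu setT _ _ (fun y =>
    (C%:E * ((density theta y)%:E +
    \sum_i ((density (theta + (k * n)%:R *: delta_mx i 0) y)%:E +
            (density (theta + - (k * n)%:R *: delta_mx i 0) y)%:E)))%E)) => //.
- apply/measurable_EFinP; apply: measurable_funM => //.
  exact: measurable_density.
- move=> y _; under eq_bigr do rewrite -EFinD.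
  rewrite sumEFin -EFinD -EFinM !abse_EFin lee_fin.
  rewrite [leRHS]ger0_norm; last first.
    rewrite mulr_ge0 ?C0// addr_ge0 ?density_ge0// sumr_ge0// => i _.
    by rewrite addr_ge0 ?density_ge0.
  rewrite (_ : density theta y + _ = (1 + \sum_i
    (expR (dot ((k * n)%:R *: delta_mx i 0) (t y)) +
     expR (dot (- (k * n)%:R *: delta_mx i 0) (t y))))
    * density theta y); last first.
    rewrite mulrDl mul1r mulr_suml; congr (_ + _); apply: eq_bigr => i _.
    by rewrite mulrDl !densityD.
  rewrite [C * (_ * density theta y)]mulrA normrM.
  rewrite (ger0_norm (density_ge0 theta y)) ler_wpM2r ?density_ge0//.
  by rewrite (le_trans (gC y))// ler_wpM2l ?C0// expR_statistic_norm_le.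
- apply: integrableZl => //; apply: integrableD => //.
    exact: integrable_density.
  apply: integrable_sum => // i _.
  by apply: integrableD => //; exact: integrable_density.
Qed.

Lemma momentD theta g1 g2 : exp_bounded g1 -> exp_bounded g2 ->
  moment theta (fun y => g1 y + g2 y) = moment theta g1 + moment theta g2.
Proof.
move=> g1b g2b; rewrite /moment -RintegralD//; try exact: integrable_moment.
by apply: eq_Rintegral => y _; rewrite mulrDl.
Qed.

Lemma momentZ theta c g : exp_bounded g ->
  moment theta (fun y => c * g y) = c * moment theta g.
Proof.
move=> gb; rewrite /moment -RintegralZl//; last exact: integrable_moment.
by apply: eq_Rintegral => y _; rewrite mulrA.
Qed.

Lemma momentB theta g1 g2 : exp_bounded g1 -> exp_bounded g2 ->
  moment theta (fun y => g1 y - g2 y) = moment theta g1 - moment theta g2.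
Proof.
move=> g1b g2b; rewrite /moment -RintegralB//; try exact: integrable_moment.
by apply: eq_Rintegral => y _; rewrite mulrBl.
Qed.

Lemma moment_sum theta (I : Type) (s : seq I) (g : I -> Y -> R) :
  (forall i, exp_bounded (g i)) ->
  moment theta (fun y => \sum_(i <- s) g i y) =
  \sum_(i <- s) moment theta (g i).
Proof.
move=> gb; elim: s => [|i s IHs].
  rewrite big_nil -[RHS](mul0r (moment theta (cst 0))) -momentZ.
    by congr moment; apply/funext => y; rewrite big_nil mul0r.
  exact: exp_bounded_cst.
rewrite big_cons -IHs -momentD//; last exact: exp_bounded_sum.
by congr moment; apply/funext => y; rewrite big_cons.
Qed.

Lemma moment_dot theta v g : exp_bounded g ->
  moment theta (fun y => dot v (t y) * g y) =
  dot (\col_i moment theta (fun y => t y i 0 * g y)) v.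
Proof.
move=> gb; have tgb i : exp_bounded (fun y => t y i 0 * g y).
  by apply: exp_boundedM gb; exact: exp_bounded_coord.
transitivity (moment theta (fun y => \sum_i v i 0 * (t y i 0 * g y))).
  congr moment; apply/funext => y; rewrite /dot mulr_suml.
  by apply: eq_bigr => i _; rewrite mulrA.
rewrite moment_sum => [|i]; last exact: exp_boundedZ.
by apply: eq_bigr => i _; rewrite mxE momentZ// mulrC.
Qed.

Lemma moment_shift theta v g :
  moment (theta + v) g = moment theta (fun y => g y * expR (dot v (t y))).
Proof. by apply: eq_Rintegral => y _; rewrite densityD mulrA. Qed.

Lemma moment_ge0 theta g : (forall y, 0 <= g y) -> 0 <= moment theta g.
Proof.
by move=> g0; apply: Rintegral_ge0 => y _; rewrite mulr_ge0 ?density_ge0.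
Qed.

Lemma le_normr_moment theta g1 g2 : exp_bounded g1 -> exp_bounded g2 ->
  (forall y, `|g1 y| <= g2 y) -> `|moment theta g1| <= moment theta g2.
Proof.
move=> g1b g2b g12.
rewrite (le_trans (le_normr_Rintegral _ (integrable_moment theta g1b)))//.
apply: le_Rintegral => //; try exact: integrable_moment.
  rewrite [X in integrable _ _ X](_ : _ =
    EFin \o (fun y => `|g1 y| * density theta y)).
    by apply: integrable_moment; exact: exp_bounded_norm.
  by apply/funext => y /=; rewrite normrM (ger0_norm (density_ge0 theta y)).
move=> y _; rewrite normrM (ger0_norm (density_ge0 theta y)).
by rewrite ler_wpM2r// density_ge0.
Qed.

(** Differentiation under the integral sign. With s = <v, t>, the first-order
remainder is the moment of g (e^s - 1 - s), which is at most
|v|^2 |g| N^2 e^N for |v| <= 1, where N is the l1 norm of t. *)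
Lemma is_diff_moment theta g : exp_bounded g ->
  is_diff theta (fun th => moment th g)
    (dot (\col_i moment theta (fun y => t y i 0 * g y))).
Proof.
move=> gb; apply/is_diffP => e e0.
pose D y := (`|g y| * (statistic_norm y * statistic_norm y)) *
  expR (1%:R * statistic_norm y).
have Nb := exp_bounded_statistic_norm.
have Db : exp_bounded D.
  apply: exp_boundedM.
    by apply: exp_boundedM; [exact: exp_bounded_norm|exact: exp_boundedM].
  apply: (@exp_bounded_expR _ 1) => // y.
  by apply: measurable_funM => //; case: Nb.
have D0 : 0 <= moment theta D.
  by apply: moment_ge0 => y; rewrite !mulr_ge0 ?expR_ge0.
have K0 : 0 < e / (moment theta D + 1) by rewrite divr_gt0// ltr_wpDl.
near=> v.
have v1 : `|v| <= 1.
  by rewrite ltW//; near: v; exact: nbhs0_lt.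
have vK : `|v| <= e / (moment theta D + 1).
  by rewrite ltW//; near: v; exact: nbhs0_lt.
have vb := exp_bounded_dot v; have evb := exp_bounded_expR_dot v.
have -> : moment (theta + v) g - moment theta g -
    dot (\col_i moment theta (fun y => t y i 0 * g y)) v =
    moment theta (fun y => g y * (expR (dot v (t y)) - 1 - dot v (t y))).
  rewrite moment_shift -moment_dot// -!momentB//.
  - by congr moment; apply/funext => y; ring.
  - by apply: exp_boundedB => //; exact: exp_boundedM.
  - exact: exp_boundedM.
  - exact: exp_boundedM.
have gDb :
  `|moment theta (fun y => g y * (expR (dot v (t y)) - 1 - dot v (t y)))| <=
    `|v| ^+ 2 * moment theta D.
  rewrite -momentZ//; apply: le_normr_moment.
  - apply: exp_boundedM => //; apply: exp_boundedB => //.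
    by apply: exp_boundedB => //; exact: exp_bounded_cst.
  - exact: exp_boundedZ.
  - move=> y; set s := dot v (t y); set N := statistic_norm y.
    have sN : `|s| <= `|v| * N by exact: normr_dot_statistic.
    have taylor : `|expR s - 1 - s| <= `|v| ^+ 2 * (N * N) * expR (1%:R * N).
      rewrite (le_trans (expR_taylor1_le s))// ler_pM ?sqr_ge0 ?expR_ge0//.
        rewrite -expr2 -exprMn -[leLHS]real_normK ?num_real//.
        by rewrite ler_sqr ?nnegrE ?mulr_ge0 ?statistic_norm_ge0.
      by rewrite ler_expR (le_trans sN)// ler_wpM2r ?statistic_norm_ge0.
    rewrite normrM (_ : _ * D y =
      `|g y| * (`|v| ^+ 2 * (N * N) * expR (1%:R * N))).
      by rewrite ler_wpM2l.
    by rewrite /D -/N; ring.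
rewrite (le_trans gDb)// expr2 -mulrA mulrC ler_wpM2r//.
rewrite (le_trans (ler_wpM2r D0 vK))// mulrAC ler_pdivrMr ?ltr_wpDl//.
by rewrite ler_wpM2l ?(ltW e0)// lerDl.
Unshelve. all: by end_near. Qed.

(** Source of all strictness: the integral vanishes only if <v, t> = c almost
everywhere on the carrier, which affine independence excludes. It serves with
q s = e^s - 1 - s for strict convexity and with q s = s^2 for the covariance. *)
Lemma moment_gt0 theta v c (q : R -> R) :
  v != 0 -> (forall s, 0 <= q s) -> (forall s, q s = 0 -> s = 0) ->
  exp_bounded (fun y => q (dot v (t y) - c)) ->
  0 < moment theta (fun y => q (dot v (t y) - c)).
Proof.
move=> v0 q0 q_eq0; set g := fun y => _ => gb.
rewrite lt_neqAle moment_ge0 ?andbT// => [|y]; last exact: q0.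
apply: contra_neq v0 => /esym m0.
apply: (statistic_affinely_independent fam (c := c)).
pose f := EFin \o (fun y => g y * density theta y).
have fint : mu.-integrable setT f by exact: integrable_moment.
have f0 : (\int[mu]_y f y = 0)%E.
  by rewrite -[LHS]fineK ?integrable_fin_num//; congr EFin.
have : ae_eq mu setT f (cst 0).
  apply/ae_eq_integral_abs => //; first by case/integrableP : fint.
  rewrite -[RHS]f0; apply: eq_integral => y _; rewrite gee0_abs// lee_fin.
  by rewrite mulr_ge0 ?density_ge0// q0.
apply: filterS => y /(_ I)[] /eqP; rewrite !mulf_eq0 => /or3P[|/eqP->|].
- by move=> /eqP/q_eq0/eqP; rewrite subr_eq0 => /eqP.
- by rewrite eqxx.
- by rewrite gt_eqF ?expR_gt0.
Qed.

Definition partition_function theta := moment theta (cst 1).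

Lemma partition_functionE theta :
  (\int[mu]_y (h y * expR (dot theta (t y)))%:E =
   (partition_function theta)%:E)%E.
Proof.
rewrite fineK; first by apply: eq_integral => y _; rewrite mul1r.
exact/integrable_fin_num/(integrable_moment theta (exp_bounded_cst 1)).
Qed.

Lemma partition_function_gt0 theta : 0 < partition_function theta.
Proof.
have := log_partition_fin_num fam theta.
by rewrite /log_partition partition_functionE/=; case: leP.
Qed.

Lemma log_partitionE :
  log_partition mu h t = EFin \o (@ln R \o partition_function).
Proof.
apply/funext => theta; rewrite /log_partition partition_functionE.
by rewrite lne_EFin// partition_function_gt0.
Qed.

Definition mean_statistic theta : 'cV[R]_n :=
  \col_i (moment theta (fun y => t y i 0) / partition_function theta).

Definition covariance_mx theta : 'M[R]_n :=
  \matrix_(i, j)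
    (moment theta (fun y => t y i 0 * t y j 0) / partition_function theta
    - mean_statistic theta i 0 * mean_statistic theta j 0).

Lemma moment_dot1 theta v :
  moment theta (fun y => dot v (t y)) =
  dot (mean_statistic theta) v * partition_function theta.
Proof.
transitivity (moment theta (fun y => dot v (t y) * cst 1 y)).
  by congr moment; apply/funext => y; rewrite mulr1.
rewrite moment_dot; last exact: exp_bounded_cst.
rewrite /dot mulr_suml; apply: eq_bigr => i _; rewrite !mxE mulrAC.
rewrite divfK ?gt_eqF ?partition_function_gt0//.
by congr (moment _ _ * _); apply/funext => y; rewrite mulr1.
Qed.

(** With v = b - a and c = <m(a), v>, integrating e^s > 1 + s at s = <v, t> - c
gives e^-c Z(b) > Z(a), as s has mean zero under the density at a. *)
Lemma log_partition_strict_subgradient :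
  strict_subgradient (@ln R \o partition_function) mean_statistic.
Proof.
move=> a b ab; pose v := b - a; pose c := dot (mean_statistic a) v.
have v0 : v != 0 by rewrite subr_eq0 eq_sym.
have sb : exp_bounded (fun y => dot v (t y) - c).
  by apply: exp_boundedB; [exact: exp_bounded_dot|exact: exp_bounded_cst].
have eb : exp_bounded (fun y => expR (- c) * expR (dot v (t y))).
  by apply: exp_boundedZ; exact: exp_bounded_expR_dot.
have oneb : exp_bounded (cst 1) by exact: exp_bounded_cst.
pose q (s : R) := expR s - 1 - s.
have qE : (fun y => q (dot v (t y) - c)) = (fun y =>
    expR (- c) * expR (dot v (t y)) - cst 1 y - (dot v (t y) - c)).
  by apply/funext => y; rewrite /q expRD mulrC.
have : 0 < moment a (fun y => q (dot v (t y) - c)).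
  apply: moment_gt0 => //.
  - by move=> s; rewrite /q -addrA -opprD subr_ge0 expR_ge1Dx.
  - move=> s; rewrite /q => qs0; apply/eqP; apply: contraT => /expR_gt1Dx.
    by lra.
  - by rewrite qE; apply: exp_boundedB => //; exact: exp_boundedB.
rewrite qE momentB//; last exact: exp_boundedB.
rewrite !momentB//; [|exact: exp_bounded_dot|exact: exp_bounded_cst].
rewrite momentZ; last exact: exp_bounded_expR_dot.
rewrite moment_dot1.
have -> : moment a (fun y => expR (dot v (t y))) = partition_function b.
  rewrite -[b](subrK a) addrC /partition_function moment_shift.
  by congr moment; apply/funext => y; rewrite mul1r.
have -> : moment a (fun=> c) = c * partition_function a.
  rewrite -momentZ//; congr moment; apply/funext => y; exact/esym/mulr1.
have -> : moment a (cst 1) = partition_function a by [].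
change (0 < expR (- c) * partition_function b - partition_function a -
  (c * partition_function a - c * partition_function a) ->
  ln (partition_function a) + c < ln (partition_function b)).
move: (partition_function_gt0 a) (partition_function_gt0 b).
move: (partition_function a) (partition_function b) => Za Zb Za0 Zb0.
by rewrite subrr subr0 subr_gt0 => ?; exact: ltr_ln_addr.
Qed.

(** Reduces the definiteness of the covariance matrix to [moment_gt0]. *)
Lemma dot_covariance theta v :
  dot (covariance_mx theta *m v) v * partition_function theta =
  moment theta (fun y => (dot v (t y) - dot (mean_statistic theta) v) ^+ 2).
Proof.
set c := dot (mean_statistic theta) v.
have db := exp_bounded_dot v.
transitivity (moment theta (fun y =>
    dot v (t y) * dot v (t y) -
    (2 * c * dot v (t y) - c ^+ 2 * cst 1 y))); last first.
  by congr moment; apply/funext => y /=; ring.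
have oneb : exp_bounded (cst 1) by exact: exp_bounded_cst.
rewrite momentB; first last.
- by apply: exp_boundedB; exact: exp_boundedZ.
- exact: exp_boundedM.
rewrite momentB; [|exact: exp_boundedZ|exact: exp_boundedZ].
rewrite !momentZ// moment_dot1 -/c -/(partition_function theta).
rewrite moment_dot//.
have Z0 := partition_function_gt0 theta.
suff -> : covariance_mx theta *m v = (partition_function theta)^-1 *:
  (\col_i moment theta (fun y => t y i 0 * dot v (t y))) -
  c *: mean_statistic theta.
  rewrite dotBl !dotZl -/c; field.
  by rewrite gt_eqF.
apply/colP => i; rewrite !mxE.
have -> : moment theta (fun y => t y i 0 * dot v (t y)) =
    \sum_j moment theta (fun y => t y i 0 * t y j 0) * v j 0.
  transitivity (moment theta (fun y => dot v (t y) * t y i 0)).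
    by congr moment; apply/funext => y; rewrite mulrC.
  rewrite moment_dot; last exact: exp_bounded_coord.
  apply: eq_bigr => j _; rewrite mxE.
  by congr (moment _ _ * _); apply/funext => y; rewrite mulrC.
rewrite mulr_sumr /c /dot mulr_suml -sumrB; apply: eq_bigr => j _.
by rewrite !mxE; ring.
Qed.

Lemma covariance_mx_unit theta : covariance_mx theta \in unitmx.
Proof.
rewrite -unitmx_tr -row_free_unit; apply/inj_row_free => w wA.
apply/eqP; apply: contraT => w0.
have v0 : w^T != 0 by rewrite trmx_eq0.
have := @moment_gt0 theta w^T (dot (mean_statistic theta) w^T)
  (fun s => s ^+ 2) v0.
rewrite -dot_covariance.
have -> : covariance_mx theta *m w^T = 0.
  by apply: trmx_inj; rewrite trmx_mul trmxK wA trmx0.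
have -> : dot 0 w^T = 0 by rewrite dotC linear0.
rewrite mul0r ltxx; apply.
- by move=> s; exact: sqr_ge0.
- by move=> s /eqP; rewrite sqrf_eq0 => /eqP.
- under eq_fun do rewrite expr2; apply: exp_boundedM; apply: exp_boundedB;
    by [exact: exp_bounded_dot|exact: exp_bounded_cst].
Qed.

Lemma covariance_mx_tr theta : (covariance_mx theta)^T = covariance_mx theta.
Proof.
apply/matrixP => i j; rewrite !mxE [_ * (moment _ _ / _)]mulrC.
by congr (moment _ _ / _ - _); apply/funext => y; rewrite mulrC.
Qed.

Lemma is_diff_mean_statistic theta :
  is_diff theta mean_statistic (mulmx (covariance_mx theta)).
Proof.
apply: is_diff_mx => i.
have Z0 : partition_function theta != 0.
  by rewrite gt_eqF ?partition_function_gt0.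
have ti := is_diff_moment theta (exp_bounded_coord i).
have Zd := is_diff_moment theta (exp_bounded_cst 1).
rewrite [X in is_diff _ X _](_ : _ =
  (fun th => moment th (fun y => t y i 0) / partition_function th)); last first.
  by apply/funext => th; rewrite mxE.
apply: is_diff_eq (is_diff_div ti Zd Z0) _; congr dot; apply/colP => j.
rewrite !mxE -/(partition_function theta).
have -> : moment theta (fun y => t y j 0 * t y i 0) =
    moment theta (fun y => t y i 0 * t y j 0).
  by congr moment; apply/funext => y; rewrite mulrC.
have -> : moment theta (fun y => t y j 0 * cst 1 y) =
    moment theta (fun y => t y j 0).
  by congr moment; apply/funext => y; rewrite mulr1.
by field.
Qed.

(** * The mean-parameter manifold *)

Lemma mean_statistic_continuous : continuous mean_statistic.
Proof.
move=> theta; apply: differentiable_continuous.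
by case: (is_diff_mean_statistic theta).
Qed.

Lemma mean_of_naturalE : mean_of_natural mu h t = mean_statistic.
Proof.
have sub := log_partition_strict_subgradient.
rewrite -(grad_subgradient sub mean_statistic_continuous).
by apply/funext => theta; rewrite /mean_of_natural log_partitionE.
Qed.

Lemma mean_of_naturalK :
  cancel (mean_of_natural mu h t) (natural_of_mean mu h t).
Proof.
rewrite mean_of_naturalE /natural_of_mean log_partitionE.
exact: grad_conjugateK log_partition_strict_subgradient
  mean_statistic_continuous.
Qed.

Lemma is_diff_natural_of_mean theta :
  is_diff (mean_of_natural mu h t theta) (natural_of_mean mu h t)
    (mulmx (invmx (covariance_mx theta))).
Proof.
rewrite mean_of_naturalE /natural_of_mean log_partitionE.
exact: is_diff_grad_conjugate log_partition_strict_subgradient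
  is_diff_mean_statistic (covariance_mx_unit theta).
Qed.

Lemma mean_metricE theta :
  mean_metric mu h t (mean_of_natural mu h t theta) =
  invmx (covariance_mx theta).
Proof.
rewrite [LHS](is_diff_hessian (is_diff_natural_of_mean theta)).
by rewrite trmx_inv covariance_mx_tr.
Qed.

(** In natural coordinates Exp is a straight line; its initial velocity
carries the metric at the starting point into the differential below. *)
Lemma mean_ExpE theta v :
  mean_Exp mu h t (mean_of_natural mu h t theta) v =
  mean_of_natural mu h t (theta + invmx (covariance_mx theta) *m v).
Proof.
rewrite /mean_Exp mean_of_naturalK; congr (mean_of_natural _ _ _ (_ + _)).
by have [_ ->] := is_diff_derive v (is_diff_natural_of_mean theta).
Qed.

Lemma is_diff_mean_Exp theta u :
  is_diff u (mean_Exp mu h t (mean_of_natural mu h t theta))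
    (mulmx (covariance_mx (theta + invmx (covariance_mx theta) *m u) *m
            invmx (covariance_mx theta))).
Proof.
set A := invmx _.
have dline : is_diff u (fun w => theta + A *m w) _ :=
  is_diffD (is_diff_cst theta u) (is_diff_linear (mulmx A) u).
have -> : mean_Exp mu h t (mean_of_natural mu h t theta) =
    mean_statistic \o (fun w => theta + A *m w).
  by apply/funext => w; rewrite mean_ExpE mean_of_naturalE.
apply: is_diff_eq (is_diff_comp dline (is_diff_mean_statistic _)) _.
by apply/funext => w; rewrite /= add0r mulmxA.
Qed.

End exponential_family_moments.

(** * The simplex *)

Section simplex.
Context {R : realType} {n : nat}.
Implicit Types (x u v a : 'cV[R]_n).

Lemma simplex_cometricE x i j :
  simplex_cometric x i j = x i 0 *+ (i == j) - x i 0 * x j 0.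
Proof. by rewrite !mxE big_ord_recl big_ord0 addr0 !mxE. Qed.

Lemma is_diff_simplex_Exp x u : open_simplex x ->
  is_diff u (simplex_Exp x)
    (mulmx (simplex_cometric (simplex_Exp x u) *m simplex_metric x)).
Proof.
move=> [x0 x1]; pose a i : 'cV[R]_n := (x i 0)^-1 *: delta_mx i 0.
have aE i w : dot (a i) w = w i 0 / x i 0.
  by rewrite dotZl dotC dot_delta mulrC.
pose E i w := x i 0 * expR (dot (a i) w).
have dE i : is_diff u (E i) (dot (E i u *: a i)) := is_diff_expR_dot _ _ _.
pose S w := \sum_i E i w.
have dS : is_diff u S (dot (\sum_i E i u *: a i)) by exact: is_diff_sum.
have S0 : S u != 0.
  apply/eqP => /psumr_eq0P E0; move/eqP : x1.
  rewrite big1 ?(eq_sym _ 1) ?oner_eq0// => i _.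
  have /eqP := E0 (fun j _ => mulr_ge0 (ltW (x0 j)) (expR_ge0 _)) i isT.
  by rewrite mulf_eq0 (gt_eqF (expR_gt0 _)) orbF => /eqP.
have ExpE w i : simplex_Exp x w i 0 = E i w / S w.
  by rewrite mxE /E aE; congr (_ / _); apply: eq_bigr => j _; rewrite /E aE.
apply: is_diff_mx => i.
under eq_fun do rewrite ExpE.
apply: is_diff_eq (is_diff_div (dE i) dS S0) _; congr dot; apply/colP => k.
have sumE : (\sum_j E j u *: a j) k 0 = E k u / x k 0.
  rewrite summxE (bigD1 k)//= big1 ?addr0 => [|j jk]; rewrite !mxE.
    by rewrite !eqxx mulr1.
  by rewrite eq_sym (negbTE jk) !mulr0.
have -> : (row i
      (simplex_cometric (simplex_Exp x u) *m simplex_metric x))^T k 0 =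
    (E i u / S u *+ (i == k) - E i u / S u * (E k u / S u)) / x k 0.
  by rewrite 2!mxE mul_mx_diag mxE simplex_cometricE !ExpE mxE.
rewrite mxE [X in _ + X]mxE [X in _ - X]mxE sumE !mxE andbT eq_sym.
have xk0 := lt0r_neq0 (x0 k).
by have [->|_] := eqVneq i k; rewrite ?mulr1n ?mulr0n; field;
  rewrite S0 xk0 ?lt0r_neq0.
Qed.

End simplex.

Theorem lemma4p4 (R : realType) :
  (forall (d : measure_display) (Y : measurableType d)
     (mu : {measure set Y -> \bar R}) (n : nat) (h : Y -> R)
     (t : Y -> 'cV[R]_n),
     regular_exponential_family mu h t ->
     forall x u v x' : 'cV[R]_n,
       mean_manifold mu h t x -> x' = mean_Exp mu h t x u ->
       mean_metric mu h t x' \in unitmx /\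
       is_derive u v (mean_Exp mu h t x)
         (invmx (mean_metric mu h t x') *m mean_metric mu h t x *m v)) /\
  (forall (n : nat) (x u v x' : 'cV[R]_n),
     open_simplex x -> simplex_tangent u -> simplex_tangent v ->
     x' = simplex_Exp x u ->
     is_derive u v (simplex_Exp x)
       (simplex_cometric x' *m simplex_metric x *m v)).
Proof.
split=> [d Y mu n h t fam x u v x' [theta _ xE] x'E|n x u v x' Sx _ _ ->].
  pose theta' := theta + invmx (covariance_mx mu h t theta) *m u.
  have GE : mean_metric mu h t x = invmx (covariance_mx mu h t theta).
    by rewrite -xE; exact: mean_metricE fam theta.
  have G'E : mean_metric mu h t x' = invmx (covariance_mx mu h t theta').
    have -> : x' = mean_of_natural mu h t theta'.
      by rewrite x'E -xE; exact: mean_ExpE fam theta u.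
    exact: mean_metricE fam theta'.
  rewrite G'E GE; split; first by rewrite unitmx_inv covariance_mx_unit.
  rewrite invmxK -xE; exact: is_diff_derive (is_diff_mean_Exp fam theta u).
exact: is_diff_derive (is_diff_simplex_Exp u Sx).
Qed.
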